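(* Let $F$ be a field with fixed algebraic closure $\overline{F}$. Let $\mathscr{M}_{2,\overline{F}}$ be the set of roots of unity $\zeta\in\overline{F}$ with $[F(\zeta):F]=2$, and let $\mathscr{C}_{2,\overline{F}}=\{F(\zeta):\zeta\in\mathscr{M}_{2,\overline{F}}\}$ be the set of quadratic cyclotomic extensions of $F$ in $\overline{F}$. Then, with $\mathcal{S}_{F,\max}$, $\nu_{p^\infty_F}$, $\ell_{p^\infty_F}$ as defined in the context: (1) $\mathscr{M}_{2,\overline{F}}$ is the disjoint union $$\mathscr{M}_{2,\overline{F}}=\coprod_{M\in\mathcal{S}_{F,\max}}\Big(\bigvee_{p\in M}\mu_{p^{\nu_{p^\infty_F}}}\ \bigvee_{p\in\mathbb{P}\setminus M}\mu_{p^{\ell_{p^\infty_F}}}\Big)\setminus\Big(\bigvee_{p\in\mathbb{P}}\mu_{p^{\ell_{p^\infty_F}}}\Big);$$ (2) the set $\mathscr{C}_{2,\overline{F}}$ is in bijection with $\mathcal{S}_{F,\max}$.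
   Context: $\mathbb{N}=\{1,2,\dots\}$; $\mathbb{P}$ is the set of primes. $\zeta_n$ denotes a primitive $n$-th root of unity in $\overline{F}$; whenever $\zeta_n$ is written it is implicitly assumed that $\operatorname{char}F\nmid n$ (in particular, in the sets below only those $k$ for which $\zeta_{p^k}$ exists are considered). $\operatorname{o}_F(\alpha)$ is the least $k\ge1$ with $\alpha^k\in F$. $\mu_n$ is the group of $n$-th roots of unity in $\overline{F}$, and $\mu_{p^\infty}=\bigcup_k\mu_{p^k}$. $\bigvee$ denotes the join of subgroups of the group of all roots of unity in $\overline F$; an infinite join is the set of finite products of elements of the groups in the family. In (1), for each $M$ the set is the difference of the group $\bigvee_{p\in M}\mu_{p^{\nu_{p^\infty_F}}}\bigvee_{p\in\mathbb{P}\setminus M}\mu_{p^{\ell_{p^\infty_F}}}$ (the join of all the listed groups) and the group $\bigvee_{p\in\mathbb{P}}\mu_{p^{\ell_{p^\infty_F}}}$, and the union over $M$ is disjoint. For $p$ prime and $e\in\mathbb{N}$: $\operatorname{t}_F(p^e)=p^e$ if $p$ is odd and $\operatorname{o}_F(\zeta_{p^e})\ne1$; $\operatorname{t}_F(2^e)=2^e$ if $\operatorname{o}_F(\zeta_{2^e})>2$; $\operatorname{t}_F(2^e)=2$ if $\operatorname{o}_F(\zeta_{2^e})=2$; $\operatorname{t}_F(p^e)=1$ if $\operatorname{o}_F(\zeta_{p^e})=1$; and $\operatorname{t}_F(1)=1$. $F$ has property $\mathcal{C}_2$ if there exists $e\in\mathbb{N}$ with $\zeta_{2^e}\notin F$,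 $\operatorname{t}_F(2^e)\ne2$ and $\zeta_{2^e}-\zeta_{2^e}^{-1}\in F$. $\ell_{p^\infty_F}=\max\{k\in\mathbb{N}\cup\{0\}:\zeta_{p^k}\in F\}$ if this maximum exists, and $\infty$ otherwise. $\nu^+_{p^\infty_F}=\max\{k\in\mathbb{N}\cup\{0\}:\zeta_{\operatorname{t}_F(p^k)}+\zeta_{\operatorname{t}_F(p^k)}^{-1}\in F\}$ if this maximum exists, and $\infty$ otherwise. $\nu_{p^\infty_F}=\nu^+_{p^\infty_F}+1$ if $p=2$ and $F$ has property $\mathcal{C}_2$, and $\nu_{p^\infty_F}=\nu^+_{p^\infty_F}$ otherwise. $\mathcal{S}_F$ is the set of nonempty subsets $S\subseteq\mathbb{P}$ for which there exist integers $e_p\in\mathbb{N}$ ($p\in S$) such that $\zeta_{p^{e_p}}\in\mathscr{M}_{2,\overline{F}}$ for every $p\in S$ and $\zeta_{\prod_{p\in B}p^{e_p}}\in\mathscr{M}_{2,\overline{F}}$ for every nonempty finite subset $B\subseteq S$. $\mathcal{S}_F$ is ordered by inclusion, and $\mathcal{S}_{F,\max}$ is the set of upper bounds in $\mathcal{S}_F$ of maximal chains of $\mathcal{S}_F$ (the upper bound of a chain being its union). *)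

(* Defs.v *)
From HB Require Import structures.
From mathcomp Require Import all_boot all_order all_algebra finmap.
From mathcomp Require Import boolp classical_sets functions cardinality.

Set Implicit Arguments.
Unset Strict Implicit.
Unset Printing Implicit Defensive.

Import GRing.Theory.
Local Open Scope classical_set_scope.
Local Open Scope ring_scope.

(* The maximum of A if it exists; [None], read as infinity, otherwise. *)
Definition max_or_infty (A : set nat) : option nat :=
  if `[< exists m, (A `&` ubound A) m >]
  then Some (xget 0%N (A `&` ubound A)) else None.

Definition primes_set : set nat := [set p | prime p].

Definition is_chain (T : Type) (S : set (set T)) (C : set (set T)) : Prop :=
  C `<=` S /\ total_on C subset.

Definition is_maximal_chain (T : Type) (S : set (set T)) (C : set (set T)) :=
  is_chain S C /\ forall D, is_chain S D -> C `<=` D -> D = C.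

(* An algebraic closure of F is an algebraically closed L with an algebraic
   embedding iota : F -> L; subfields and extensions of F are subsets of L. *)
Section Extensions.
Variables (F : fieldType) (L : closedFieldType) (iota : {rmorphism F -> L}).

Definition base_field : set L := range iota.

Definition adjoin (a : L) : set L :=
  smallest (fun K : set L => GRing.divring_closed [in K])
           (base_field `|` [set a]).

(* [K : F] = n: K has an F-basis with n elements. *)
Definition has_degree (K : set L) (n : nat) : Prop :=
  exists b : 'I_n -> L, (forall i, K (b i)) /\
    forall x, K x ->
      exists! c : {ffun 'I_n -> F}, x = \sum_(i < n) iota (c i) * b i.

Definition roots_of_unity : set L :=
  [set x | exists2 n, (0 < n)%N & n.-unity_root x].

Definition M2 : set L :=
  [set z | roots_of_unity z /\ has_degree (adjoin z) 2].

Definition C2 : set (set L) := [set adjoin z | z in M2].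

Definition mu (n : nat) : set L := [set x | n.-unity_root x].

(* mu_{p^k} for k possibly infinite. *)
Definition mu_pow (p : nat) (k : option nat) : set L :=
  if k is Some k' then mu (p ^ k')%N
  else \bigcup_(j in [set: nat]) mu (p ^ j)%N.

(* The join of a family of groups of roots of unity. *)
Definition join (G : set (set L)) : set L :=
  [set x | exists2 s : seq L,
     (forall y, y \in s -> (\bigcup_(H in G) H) y) & x = \prod_(y <- s) y].

(* The least k >= 1 with a ^+ k in F (and 0 if there is none, which does not
   happen for roots of unity). *)
Definition ord_mod_base (a : L) : nat :=
  let A := [set k | (0 < k)%N /\ base_field (a ^+ k)] in
  xget 0%N (A `&` lbound A).

Definition zeta_exists (n : nat) : Prop := n%:R != 0 :> F.

(* zeta n is a primitive n-th root of unity whenever char F does not divide n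
   (n = 0 is excluded as 0%:R = 0); its other values are irrelevant, so that
   uses of zeta n below are guarded by zeta_exists n. *)
Definition primitive_roots_choice (zeta : nat -> L) : Prop :=
  forall n, zeta_exists n -> n.-primitive_root (zeta n).

Variable zeta : nat -> L.

(* t_F(p^e), for p prime. *)
Definition tF (p e : nat) : nat :=
  let o := ord_mod_base (zeta (p ^ e)%N) in
  if o == 1%N then 1%N
  else if (p == 2%N) && (o == 2%N) then 2%N
  else (p ^ e)%N.

Definition property_C2 : Prop :=
  exists e, let z := zeta (2 ^ e)%N in
    [/\ (0 < e)%N, zeta_exists (2 ^ e)%N, ~ base_field z,
        tF 2 e <> 2%N & base_field (z - z^-1)].

Definition ell (p : nat) : option nat :=
  max_or_infty
    [set k | zeta_exists (p ^ k)%N /\ base_field (zeta (p ^ k)%N)].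

Definition nu_plus (p : nat) : option nat :=
  max_or_infty
    [set k | zeta_exists (p ^ k)%N /\
             base_field (zeta (tF p k) + (zeta (tF p k))^-1)].

Definition nu (p : nat) : option nat :=
  if (p == 2%N) && `[< property_C2 >] then omap succn (nu_plus p)
  else nu_plus p.

Definition SF : set (set nat) :=
  [set S | [/\ S !=set0, S `<=` primes_set &
    exists e : nat -> nat,
      (forall p, S p -> [/\ (0 < e p)%N, zeta_exists (p ^ e p)%N
                          & M2 (zeta (p ^ e p)%N)]) /\
      (forall B : {fset nat}, B != fset0 -> [set` B] `<=` S ->
         let n := (\prod_(p <- B) p ^ e p)%N in
         zeta_exists n /\ M2 (zeta n))]].

Definition SF_max : set (set nat) :=
  [set M | SF M /\
     exists2 C, is_maximal_chain SF C & M = \bigcup_(S in C) S].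

Definition mu_ell_join : set L :=
  join [set mu_pow p (ell p) | p in primes_set].

Definition mu_nu_ell_join (M : set nat) : set L :=
  join ([set mu_pow p (nu p) | p in M] `|`
        [set mu_pow p (ell p) | p in primes_set `\` M]).

End Extensions.

(* Main.v *)
(** A root of unity [z] is quadratic iff [z] is not in F and [z^2 = s z - n] with
    [s], [n] in F; then F(z) = F + Fz. The quadratic extensions generated by roots
    of unity of p-power order form a chain, so there is at most one of them for
    each prime p. Hence SF consists of the nonempty sets of primes that generate a
    common quadratic extension K, and SF_max of the sets of all primes generating
    K, one for each K in C2; the prime-power parts of a root of unity in K that
    lie outside F show that this set is nonempty.

    It remains to see that [nu p] bounds the p-power roots of unity of K when p
    generates K. The conjugate of such a root [z] of order p^k is [z^a] with
    [a^2 = 1] modulo p^k. For odd p this forces [z^a = z^-1], so that [z + z^-1]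
    is in F. For p = 2 it forces [z^a] to be [- z], [z^-1] or [- z^-1], so that
    [z^2], [z + z^-1] or [z - z^-1] is in F; the first two cases make up the set
    defining [nu_plus], and the third one alone is property C2, which adds exactly
    one level. *)

Require Import Defs.
From HB Require Import structures.
From mathcomp Require Import all_boot all_order all_algebra finmap.
From mathcomp Require Import boolp classical_sets functions cardinality.
From mathcomp Require Import ring zify.

Set Implicit Arguments.
Unset Strict Implicit.
Unset Printing Implicit Defensive.

Import GRing.Theory.
Local Open Scope classical_set_scope.
Local Open Scope ring_scope.
Local Open Scope card_scope.

Section CyclotomicExtensions.
Variables (F : fieldType) (L : closedFieldType) (iota : {rmorphism F -> L}).
Local Notation base := (base_field iota).

(** * Subfields of [L] containing the image of [F], represented as sets *)

Definition intermediate (K : set L) : Prop :=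
  GRing.divring_closed [in K] /\ base `<=` K.

Section Intermediate.
Variable K : set L.
Hypothesis intK : intermediate K.

Lemma intermediate_iota a : K (iota a).
Proof. by apply: intK.2; exists a. Qed.

Lemma intermediate1 : K 1.
Proof. by rewrite -(rmorph1 iota); apply: intermediate_iota. Qed.

Lemma intermediate0 : K 0.
Proof. by rewrite -(rmorph0 iota); apply: intermediate_iota. Qed.

Lemma intermediateB x y : K x -> K y -> K (x - y).
Proof.
case: intK => -[_ KB _] _ Kx Ky.
by have := KB x y; rewrite !inE; apply.
Qed.

Lemma intermediate_div x y : K x -> K y -> K (x / y).
Proof.
case: intK => -[_ _ KV] _ Kx Ky.
by have := KV x y; rewrite !inE; apply.
Qed.

Lemma intermediateN x : K x -> K (- x).
Proof. by move=> Kx; rewrite -sub0r; apply: intermediateB intermediate0 _. Qed.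

Lemma intermediateD x y : K x -> K y -> K (x + y).
Proof.
by move=> Kx Ky; rewrite -[y]opprK; apply: intermediateB (intermediateN Ky).
Qed.

Lemma intermediateV x : K x -> K x^-1.
Proof. by move=> Kx; rewrite -div1r; apply: intermediate_div intermediate1 _. Qed.

Lemma intermediateM x y : K x -> K y -> K (x * y).
Proof.
by move=> Kx Ky; rewrite -[y]invrK; apply: intermediate_div (intermediateV Ky).
Qed.

Lemma intermediateX x n : K x -> K (x ^+ n).
Proof.
by move=> Kx; elim: n => [|n IHn]; rewrite ?exprS; [apply: intermediate1 | apply: intermediateM].
Qed.

Lemma intermediate_prod (s : seq L) :
  (forall y, y \in s -> K y) -> K (\prod_(y <- s) y).
Proof.
elim: s => [|x s IHs] sK; rewrite ?big_nil ?big_cons; first exact: intermediate1.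
apply: intermediateM; first by apply: sK; rewrite mem_head.
by apply: IHs => y ys; apply: sK; rewrite inE ys orbT.
Qed.

(** The two given elements add up to twice [x]. Applied to [z] and [z^-1], this keeps [z + z^-1] and
    [z - z^-1] from both being in the base field. *)
Lemma intermediate_subK x y : K (x + y) -> K (x - y) -> ~ K x -> 2 = 0 :> L.
Proof.
move=> KD KB Kx; apply: contrapT => /eqP n2; apply: Kx.
have -> : x = (x + y + (x - y)) / 2 by field.
apply: intermediate_div; first exact: intermediateD.
by rewrite -(rmorph_nat iota 2); apply: intermediate_iota.
Qed.

End Intermediate.

Lemma intermediate_base : intermediate base.
Proof.
split=> //; split.
- by rewrite inE; exists 1; rewrite // rmorph1.
- by move=> x y; rewrite !inE => -[a _ <-] [b _ <-]; exists (a - b); rewrite // rmorphB.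
- by move=> x y; rewrite !inE => -[a _ <-] [b _ <-]; exists (a / b); rewrite // fmorph_div.
Qed.

Lemma adjoin_min K a : intermediate K -> K a -> adjoin iota a `<=` K.
Proof. by move=> [Kd bK] Ka; apply: smallest_sub => // x [/bK//|->]. Qed.

Lemma adjoin_gen a : adjoin iota a a.
Proof. by apply: sub_gen_smallest; right. Qed.

Lemma intermediate_adjoin a : intermediate (adjoin iota a).
Proof.
split; last by move=> x bx; apply: sub_gen_smallest; left.
split.
- by rewrite inE => K [[]]; rewrite inE.
- move=> x y; rewrite !inE => Kx Ky K KP; have := KP.1.
  move=> [_ /(_ x y) + _]; rewrite !inE; apply; [exact: Kx | exact: Ky].
- move=> x y; rewrite !inE => Kx Ky K KP; have := KP.1.
  move=> [_ _ /(_ x y)]; rewrite !inE; apply; [exact: Kx | exact: Ky].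
Qed.

Lemma adjoin_eq a b :
  adjoin iota a b -> adjoin iota b a -> adjoin iota a = adjoin iota b.
Proof.
by move=> ab ba; apply/seteqP; split; apply: adjoin_min => //; apply: intermediate_adjoin.
Qed.

(** * Quadratic elements and extensions of degree two *)

(** The computational form of degree two, with [s] the trace and [n] the norm of [z];
    [has_degree_quadratic] and [quadratic_has_degree] relate it to [has_degree]. *)
Definition quadratic (z : L) : Prop :=
  ~ base z /\ exists s n, z ^+ 2 = iota s * z - iota n.

Lemma base_affine z a b : ~ base z -> base (iota a + iota b * z) -> b = 0.
Proof.
move=> zF [c _ e]; apply/eqP/negP => /negP b0; apply: zF.
exists ((c - a) / b) => //; rewrite fmorph_div rmorphB /= e addrC addKr mulrC mulKf //.
by rewrite fmorph_eq0.
Qed.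

Lemma affine_eq0 z a b : ~ base z -> iota a + iota b * z = 0 -> a = 0 /\ b = 0.
Proof.
move=> zF e; have b0 : b = 0.
  by apply: (base_affine (a := a) zF); rewrite e; exact: (intermediate0 intermediate_base).
split=> //; apply/eqP; rewrite -(fmorph_eq0 iota); apply/eqP.
by rewrite -e b0 rmorph0 mul0r addr0.
Qed.

Lemma adjoin_quadratic z : quadratic z ->
  adjoin iota z = [set x | exists a b, x = iota a + iota b * z].
Proof.
move=> [zF [s [n zz]]]; set S := [set x | _].
have intz := intermediate_adjoin z.
apply/seteqP; split; last first.
  move=> x [a [b ->]]; apply: (intermediateD intz); first exact: (intermediate_iota intz).
  by apply: (intermediateM intz); [exact: (intermediate_iota intz)|exact: adjoin_gen].
apply: adjoin_min; last by exists 0, 1; rewrite rmorph0 rmorph1 add0r mul1r.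
split; last by move=> x [a _ <-]; exists a, 0; rewrite rmorph0 mul0r addr0.
have SM x y : S x -> S y -> S (x * y).
  move=> [a [b ->]] [c [d ->]].
  exists (a * c - b * d * n), (a * d + b * c + b * d * s).
  rewrite rmorphB !rmorphD !rmorphM /=.
  have -> : forall A B C D : L, (A + B * z) * (C + D * z) =
      A * C + (A * D + B * C) * z + B * D * z ^+ 2 by move=> *; ring.
  by rewrite zz; ring.
have SV x : S x -> S x^-1.
  move=> [a [b ->]].
  have [->|ab0] := eqVneq (iota a + iota b * z) 0.
    by exists 0, 0; rewrite invr0 rmorph0 mul0r addr0.
  (* [N] is the norm of [a + b z], its product with the conjugate [a + b s - b z]; the inverse is
     the conjugate divided by [N]. *)
  set N := a ^+ 2 + a * b * s + b ^+ 2 * n.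
  have eN : (iota a + iota b * z) * (iota (a + b * s) + iota (- b) * z) = iota N.
    rewrite /N !expr2 !rmorphD rmorphN !rmorphM /=.
    transitivity (iota a * iota a + iota a * iota b * iota s +
      iota b * iota b * iota s * z - iota b * iota b * z ^+ 2); first by ring.
    by rewrite zz; ring.
  have N0 : N != 0.
    apply: contraNneq ab0 => N0; move/eqP: eN; rewrite N0 rmorph0 mulf_eq0.
    case/orP => [//|/eqP /(affine_eq0 zF) [e1 /eqP]].
    rewrite oppr_eq0 => /eqP b0; move: e1; rewrite b0 mul0r addr0 => ->.
    by rewrite rmorph0 mul0r addr0.
  exists ((a + b * s) / N), (- b / N); rewrite !fmorph_div.
  apply: (mulfI ab0); rewrite mulfV // -[_ / _ * z]mulrAC -mulrDl mulrA eN mulfV //.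
  by rewrite fmorph_eq0.
split.
- by rewrite inE; exists 1, 0; rewrite rmorph0 rmorph1 mul0r addr0.
- move=> x y; rewrite !inE => -[a [b ->]] [c [d ->]]; exists (a - c), (b - d).
  by rewrite !rmorphB /=; ring.
- by move=> x y; rewrite !inE => Sx Sy; apply: SM => //; apply: SV.
Qed.

(** An element [a + b z] outside F has [b] nonzero, so [z] can be recovered from it. *)
Lemma quadratic_adjoin z y : quadratic z -> adjoin iota z y -> ~ base y ->
  quadratic y /\ adjoin iota y = adjoin iota z.
Proof.
move=> qz zy yF; have [zF [s [n zz]]] := qz.
have [a [b ey]] : exists a b, y = iota a + iota b * z.
  by move: zy; rewrite adjoin_quadratic.
have b0 : b != 0.
  by apply/eqP => b0; apply: yF; exists a; rewrite // ey b0 rmorph0 mul0r addr0.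
split.
  (* The trace and the norm of [a + b z]. *)
  split=> //; exists (a + a + b * s), (a ^+ 2 + a * b * s + b ^+ 2 * n).
  rewrite ey !expr2 !rmorphD !rmorphM /=.
  transitivity (iota a ^+ 2 + (iota a + iota a) * iota b * z + iota b ^+ 2 * z ^+ 2); first by ring.
  by rewrite zz; ring.
apply: adjoin_eq => //.
have inty := intermediate_adjoin y.
have -> : z = (y - iota a) / iota b by rewrite ey addrC addKr mulrC mulKf ?fmorph_eq0.
apply: (intermediate_div inty); last exact: (intermediate_iota inty).
by apply: (intermediateB inty); [exact: adjoin_gen|exact: (intermediate_iota inty)].
Qed.

Lemma has_degree_quadratic z : quadratic z -> has_degree iota (adjoin iota z) 2.
Proof.
move=> qz; have [zF _] := qz.
exists (fun i : 'I_2 => z ^+ i); split.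
  by move=> i; exact: (intermediateX (intermediate_adjoin z) _ (@adjoin_gen z)).
rewrite adjoin_quadratic // => x [a [b ->]].
exists [ffun i : 'I_2 => if i == ord0 then a else b]; split.
  by rewrite !big_ord_recl big_ord0 !ffunE /= expr0 expr1 mulr1 addr0.
move=> c; rewrite !big_ord_recl big_ord0 /= expr0 expr1 mulr1 addr0.
set c0 := c _; set c1 := c _ => e.
have [] := @affine_eq0 z (a - c0) (b - c1) zF.
  rewrite !rmorphB /=.
  transitivity ((iota a + iota b * z) - (iota c0 + iota c1 * z)); first by ring.
  by rewrite e subrr.
move=> /eqP; rewrite subr_eq0 => /eqP ea /eqP; rewrite subr_eq0 => /eqP eb.
apply/ffunP => i; rewrite ffunE; case: ifP => [/eqP ->//|].
case: i => -[|[|//]] ? // _; rewrite eb; congr (c _); exact: val_inj.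
Qed.

Lemma linear_relation3 (v : 'I_3 -> {ffun 'I_2 -> F}) :
  exists c : 'I_3 -> F, (exists i, c i != 0) /\
    forall j, \sum_i c i * v i j = 0.
Proof.
pose A := \matrix_(i < 3, j < 2) v i j.
have : kermx A != 0.
  rewrite -mxrank_eq0 mxrank_ker -lt0n subn_gt0.
  by apply: leq_ltn_trans (rank_leq_col A) _.
case/rowV0Pn => u /sub_kermxP uA u0; exists (u 0); split.
  apply: contrapT => nu; case/eqP: u0; apply/rowP => i; rewrite mxE.
  by apply/eqP/negPn/negP => ui; apply: nu; exists i.
move=> j; have := congr1 (fun M : 'rV_2 => M 0 j) uA; rewrite !mxE => uA0.
rewrite -[RHS]uA0; by apply: eq_bigr => i _; rewrite mxE.
Qed.

(** In dimension two 1, [z] and [z ^+ 2] are linearly dependent; as [z] is not in F, the coefficient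
    of [z ^+ 2] is nonzero and can be divided out. *)
Lemma quadratic_has_degree z : has_degree iota (adjoin iota z) 2 -> quadratic z.
Proof.
move=> [b [bK bP]].
have intz := intermediate_adjoin z.
have sum2 (c : 'I_2 -> F) : \sum_i iota (c i) * b i =
    iota (c ord0) * b ord0 + iota (c ord_max) * b ord_max.
  rewrite !big_ord_recl big_ord0 addr0.
  by have -> : lift ord0 ord0 = ord_max :> 'I_2 by apply: val_inj.
have b_free (c : 'I_2 -> F) : \sum_i iota (c i) * b i = 0 -> forall i, c i = 0.
  move=> c0 i; have [f [_ uf]] := bP 0 (intermediate0 intz).
  have fc : f = finfun c.
    by apply: uf; rewrite -[LHS]c0; apply: eq_bigr => j _; rewrite ffunE.
  have f0 : f = [ffun=> 0].
    by apply: uf; rewrite big1 // => j _; rewrite ffunE rmorph0 mul0r.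
  by move/ffunP: f0 => /(_ i); rewrite fc !ffunE.
have zF : ~ base z.
  (* If [z] were in F, both basis vectors would be in F and hence be dependent. *)
  move=> zF; have Kb : adjoin iota z `<=` base by apply: adjoin_min => //; apply: intermediate_base.
  have [c0 _ e0] := Kb _ (bK ord0); have [c1 _ e1] := Kb _ (bK ord_max).
  have c10 : c1 = 0.
    apply: (b_free (fun i => if i == ord0 then c1 else - c0) _ ord0).
    by rewrite sum2 /= -e0 -e1 rmorphN; ring.
  have /eqP := oner_neq0 F; apply.
  apply: (b_free (fun i => if i == ord0 then 0 else 1) _ ord_max).
  by rewrite sum2 /= -e1 c10 !rmorph0 mul0r mulr0 addr0.
split=> //.
have pow_rep (i : 'I_3) : exists c : {ffun 'I_2 -> F}, z ^+ i = \sum_j iota (c j) * b j.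
  have [|c [ec _]] := bP (z ^+ i); last by exists c.
  exact: (intermediateX intz _ (@adjoin_gen z)).
have [f fP] := choice pow_rep.
have [c [[k ck] cf]] := linear_relation3 f.
have rel : \sum_(i < 3) iota (c i) * z ^+ i = 0.
  under eq_bigr => i _ do rewrite fP mulr_sumr.
  rewrite exchange_big big1 //= => j _.
  under eq_bigr => i _ do rewrite mulrA -rmorphM.
  by rewrite -mulr_suml -rmorph_sum cf rmorph0 mul0r.
move: rel; rewrite !big_ord_recl big_ord0 /= expr0 mulr1 addr0 -![bump _ _]/(S _) expr1.
set a0 := c _; set a1 := c _; set a2 := c _ => rel.
have a20 : a2 != 0.
  apply/eqP => a20; move: rel; rewrite a20 rmorph0 mul0r addr0 => /(affine_eq0 zF) [a00 a10].
  case/eqP: ck; case: k => -[|[|[|//]]] k3.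
  - by rewrite -a00; congr c; apply: val_inj.
  - by rewrite -a10; congr c; apply: val_inj.
  - by rewrite -a20; congr c; apply: val_inj.
exists (- a1 / a2), (a0 / a2); apply: (@mulfI _ (iota a2)); first by rewrite fmorph_eq0.
rewrite !fmorph_div rmorphN; have := fmorph_eq0 iota a2; rewrite (negPf a20) => /negbT a20'.
apply/eqP; rewrite -subr_eq0; apply/eqP; rewrite -[RHS]rel.
by field.
Qed.

(** * Traces, norms and conjugates of quadratic roots of unity *)

Lemma quadratic_sq z : ~ base z -> base (z ^+ 2) -> quadratic z.
Proof.
by move=> zF [c _ ec]; split=> //; exists 0, (- c); rewrite rmorph0 rmorphN mul0r sub0r opprK.
Qed.

Lemma quadratic_addV z : ~ base z -> base (z + z^-1) -> quadratic z.
Proof.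
move=> zF [c _ ec]; split=> //; exists c, 1; rewrite ec rmorph1.
have z0 : z != 0 by apply/eqP => z0; apply: zF; rewrite z0; exact: (intermediate0 intermediate_base).
by field.
Qed.

Lemma quadratic_subV z : ~ base z -> base (z - z^-1) -> quadratic z.
Proof.
move=> zF [c _ ec]; split=> //; exists c, (- 1); rewrite ec rmorphN rmorph1.
have z0 : z != 0 by apply/eqP => z0; apply: zF; rewrite z0; exact: (intermediate0 intermediate_base).
by field.
Qed.

(* [z'] is the Galois conjugate of [z] over [base]; as the powers of [z] and of
   [z'] have the same coordinates over [base], it is again an [n]-th root of
   unity, and exchanging [z] and [z'] gives [z ^+ (a * a) = z]. *)
Lemma quadratic_conj z n : quadratic z -> n.-primitive_root z ->
  exists a, [/\ z ^+ a != z, z ^+ (a * a) = z & base (z + z ^+ a) /\ base (z * z ^+ a)].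
Proof.
move=> [zF [s [m zz]]] zn; pose z' := iota s - z.
have zz' : z * z' = iota m by rewrite /z' mulrBr -expr2 zz; ring.
have zz2 : z' ^+ 2 = iota s * z' - iota m.
  by rewrite /z' -zz' /z'; ring.
have powers k : exists al be,
    z ^+ k = iota al + iota be * z /\ z' ^+ k = iota al + iota be * z'.
  elim: k => [|k [al [be [e e']]]].
    by exists 1, 0; rewrite !expr0 rmorph1 rmorph0 !mul0r addr0.
  exists (- (be * m)), (al + be * s).
  rewrite !exprSr e e' !mulrDl -!mulrA -!expr2 zz zz2 rmorphN rmorphD !rmorphM /=.
  by split; ring.
have rep_inj al be al' be' :
    iota al + iota be * z = iota al' + iota be' * z -> al = al' /\ be = be'.
  move=> e; have [] := @affine_eq0 z (al - al') (be - be') zF.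
    rewrite !rmorphB /=.
    transitivity ((iota al + iota be * z) - (iota al' + iota be' * z)); first by ring.
    by rewrite e subrr.
  by move=> /eqP; rewrite subr_eq0 => /eqP -> /eqP; rewrite subr_eq0 => /eqP ->.
have z'n : z' ^+ n = 1.
  have [al [be [e ->]]] := powers n.
  have [|-> ->] := rep_inj al be 1 0; last by rewrite rmorph1 rmorph0 mul0r addr0.
  by rewrite -e (prim_expr_order zn) rmorph1 rmorph0 mul0r addr0.
have [[a _] /= ea] := prim_rootP zn z'n.
exists a; rewrite -ea; split.
(* Separability: if [z' = z] then [2 z = s], so [z] is in F unless 2 vanishes. In characteristic 2,
   [s = 0] puts [z ^+ 2] in F, and [z] is a power of [z ^+ 2] because its order [n] is odd. *)
- apply/eqP => e; have e2 : z *+ 2 = iota s by rewrite mulr2n -{1}e /z' subrK.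
  have n0 : n%:R != 0 :> L := prim_root_natf_neq0 zn.
  have [c2|c2] := eqVneq (2 : L) 0; last first.
    apply: zF; exists (s / 2) => //; rewrite fmorph_div -e2 rmorph_nat -[z *+ 2]mulr_natr.
    by rewrite mulfK.
  have s0 : iota s = 0 by rewrite -e2 -[z *+ 2]mulr_natr c2 mulr0.
  have nodd : odd n.
    apply: contraNT n0 => n_even; rewrite -(odd_double_half n) (negPf n_even) add0n.
    by rewrite -muln2 natrM c2 mulr0.
  apply: zF; have := prim_expr_order zn.
  rewrite -(odd_double_half n) nodd add1n => h.
  have -> : z = (z ^+ 2) ^+ (n./2.+1).
    by rewrite -exprM mulnC muln2 doubleS exprS h mulr1.
  apply: (intermediateX intermediate_base); rewrite zz s0 mul0r sub0r -rmorphN; exact: (intermediate_iota intermediate_base).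
- rewrite exprM -ea; have [al [be [e ->]]] := powers a.
  have [|-> ->] := rep_inj al be s (- 1); last by rewrite rmorphN rmorph1 /z'; ring.
  by rewrite -e -ea rmorphN rmorph1 /z'; ring.
- rewrite zz' /z' addrC subrK; split; exact: (intermediate_iota intermediate_base).
Qed.

(** [p ^ k] divides [(a - 1)(a + 1)], and an odd [p] divides at most one factor. It is not [a - 1]
    that absorbs [p ^ k], since the conjugate differs from [z]; hence the trace is [z + z^-1]. *)
Lemma quadratic_odd_prime p k z : prime p -> odd p -> (p ^ k)%N.-primitive_root z ->
  quadratic z -> base (z + z^-1).
Proof.
move=> pr_p odd_p zn qz; have [a [naz aaz [tr _]]] := quadratic_conj qz zn.
have [zF _] := qz.
suff -> : z^-1 = z ^+ a by [].
have z0 : z != 0 by rewrite (prim_root_eq0 zn) -lt0n expn_gt0 prime_gt0.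
have a0 : (0 < a)%N.
  case: a aaz {naz tr} => // z1; case: zF; rewrite -z1; exact: (intermediate1 intermediate_base).
have aa : (p ^ k %| (a - 1) * (a + 1))%N.
  move/eqP: aaz; rewrite -{2}(expr1 z) (eq_prim_root_expr zn) eqn_mod_dvd ?muln_gt0 ?a0 //.
  by congr (_ %| _)%N; nia.
apply: (mulfI z0); rewrite mulfV // -exprS.
apply/esym/eqP; rewrite -(prim_order_dvd zn).
have [pa|pa] := boolP (p %| a - 1)%N; last first.
  by move: aa; rewrite Gauss_dvdr ?addn1 // coprimeXl // prime_coprime.
case/eqP: naz; apply/eqP; rewrite -{2}(expr1 z) (eq_prim_root_expr zn) eqn_mod_dvd //.
move: aa; rewrite Gauss_dvdl // coprimeXl // prime_coprime //; apply/negP => pa1.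
have : (p %| 2)%N.
  by rewrite -(dvdn_addr _ pa); move: pa1; congr (_ %| _)%N; lia.
by move/dvdn_leq => /(_ isT) p2; have := prime_gt1 pr_p; case: p p2 odd_p {pr_p zn pa pa1} => [|[|[|]]].
Qed.

Lemma quadratic_2pow k z : (2 ^ k)%N.-primitive_root z -> quadratic z ->
  [\/ base (z ^+ 2), base (z + z^-1) | base (z - z^-1)].
Proof.
move=> zn qz; have [a [naz aaz [tr nm]]] := quadratic_conj qz zn.
have [zF _] := qz.
have z0 : z != 0 by rewrite (prim_root_eq0 zn) -lt0n expn_gt0.
have a0 : (0 < a)%N.
  case: a aaz {naz tr nm} => // z1; case: zF; rewrite -z1; exact: (intermediate1 intermediate_base).
have k0 : (0 < k)%N.
  case: k zn => // /prim_expr_order; rewrite expr1 => z1; case: zF; rewrite z1.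
  exact: (intermediate1 intermediate_base).
have aa : (2 ^ k %| (a - 1) * (a + 1))%N.
  move/eqP: aaz; rewrite -{2}(expr1 z) (eq_prim_root_expr zn) eqn_mod_dvd ?muln_gt0 ?a0 //.
  by congr (_ %| _)%N; nia.
have a_odd : odd a.
  have : (2 %| (a - 1) * (a + 1))%N by apply: dvdn_trans aa; rewrite dvdn_exp.
  by rewrite Euclid_dvdM //= !dvdn2; lia.
have half b : odd b -> (2 ^ k %| 2 * b * (a - 1))%N \/ (2 ^ k %| 2 * b * (a + 1))%N ->
    (2 ^ k %| 2 * (a - 1))%N \/ (2 ^ k %| 2 * (a + 1))%N.
  move=> b_odd; have cb : coprime (2 ^ k) b by rewrite coprimeXl // coprime2n.
  by rewrite ![(2 * b)%N]mulnC -!mulnA !(Gauss_dvdr _ cb).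
have [h|h] : (2 ^ k %| 2 * (a - 1))%N \/ (2 ^ k %| 2 * (a + 1))%N.
  (* Exactly one of the even numbers [a - 1] and [a + 1] is divisible by 4; half of the other one is
     odd and is cancelled by [half]. *)
  have [a4|a4] := boolP (4 %| a - 1)%N.
    have /half : odd ((a + 1) %/ 2) by lia.
    apply; left; move: aa; congr (_ %| _)%N.
    by rewrite mulnC; congr (_ * _)%N; lia.
  have /half : odd ((a - 1) %/ 2) by lia.
  apply; right; move: aa; congr (_ %| _)%N.
  by congr (_ * _)%N; lia.
(* The conjugate can only be [- z], and then the norm is [- z ^+ 2]. *)
- have : (z ^+ (a - 1)) ^+ 2 == 1 by rewrite -exprM mulnC -(prim_order_dvd zn).
  rewrite sqrf_eq1 => /orP [/eqP e|/eqP e].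
    by case/eqP: naz; rewrite -(subnK a0) exprD e mul1r expr1.
  constructor 1; move: nm; rewrite -(subnK a0) exprD e mulN1r expr1 mulrN.
  by move/(intermediateN intermediate_base); rewrite opprK.
(* The conjugate is [z^-1] or [- z^-1], and the trace gives the last two cases. *)
- have : (z ^+ (a + 1)) ^+ 2 == 1 by rewrite -exprM mulnC -(prim_order_dvd zn).
  have eV : z ^+ a = z ^+ (a + 1) * z^-1 by rewrite exprD expr1 mulfK.
  rewrite sqrf_eq1 => /orP [/eqP e|/eqP e].
    by constructor 2; rewrite -(mul1r z^-1) -e -eV.
  by constructor 3; rewrite -(mulN1r z^-1) -e -eV.
Qed.
(** Chebyshev recurrence; the induction carries two consecutive exponents. *)
Lemma base_addV_exp z c : z != 0 -> base (z + z^-1) -> base (z ^+ c + (z ^+ c)^-1).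
Proof.
move=> z0 zF; have bI := intermediate_base.
suff [] : base (z ^+ c + (z ^+ c)^-1) /\ base (z ^+ c.+1 + (z ^+ c.+1)^-1) by [].
elim: c => [|c [IH1 IH2]]; rewrite ?expr0 ?expr1 ?invr1.
  by split=> //; apply: (intermediateD bI); exact: (intermediate1 bI).
split=> //.
have -> : z ^+ c.+2 + (z ^+ c.+2)^-1 =
    (z + z^-1) * (z ^+ c.+1 + (z ^+ c.+1)^-1) - (z ^+ c + (z ^+ c)^-1).
  by rewrite !exprS; field; rewrite z0 expf_neq0.
by apply: (intermediateB bI) => //; apply: (intermediateM bI).
Qed.

(** * Maxima of sets of exponents and orders modulo the base field *)

Lemma max_or_infty_Some (A : set nat) m : A m -> (forall k, A k -> (k <= m)%N) ->
  max_or_infty A = Some m.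
Proof.
move=> Am mA; have AUm : (A `&` ubound A) m by split.
rewrite /max_or_infty asboolT; last by exists m.
congr Some; apply: xget_subset1 => // i j [Ai iA] [Aj jA].
by apply/eqP; rewrite eqn_leq; apply/andP; split; [apply: jA | apply: iA].
Qed.

(** An initial segment is recovered from its maximum, [None] standing for all naturals; [mu_powP]
    reads exponents in the same way. *)
Lemma max_or_infty_prefix (A : set nat) k : A 0%N ->
    (forall i j, (i <= j)%N -> A j -> A i) ->
  A k <-> (if max_or_infty A is Some m then (k <= m)%N else true).
Proof.
move=> A0 A_down.
have [[m [Am mA]]|nmax] := pselect (exists m, (A `&` ubound A) m).
  rewrite (max_or_infty_Some Am mA); split; first exact: mA.
  by move=> /A_down; apply.
rewrite /max_or_infty asboolF //; split=> // _; elim: k => // k Ak.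
apply: contrapT => nAk; apply: nmax; exists k; split=> // j Aj.
by have [//|] := leqP j k => /A_down/(_ Aj).
Qed.

(** Positivity of [k] excludes the default value 0 of [xget]. *)
Lemma ord_mod_baseP z k : (0 < k)%N ->
  ord_mod_base iota z = k <->
  base (z ^+ k) /\ forall j, (0 < j)%N -> base (z ^+ j) -> (k <= j)%N.
Proof.
move=> k0; rewrite /ord_mod_base; set A := [set k | _]; split.
  case: xgetP => [x -> [[_ ?] lb] <-|_ e]; last by rewrite -e in k0.
  by split=> // j j0 bj; apply: lb.
move=> [bk lbk]; apply: xget_subset1; first by split=> // j [j0 bj]; apply: lbk.
move=> i j [Ai iA] [Aj jA].
by apply/eqP; rewrite eqn_leq; apply/andP; split; [apply: iA | apply: jA].
Qed.

Lemma ord_mod_base1 z : ord_mod_base iota z = 1%N <-> base z.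
Proof. by rewrite ord_mod_baseP // expr1; split=> [[]|]. Qed.

Lemma ord_mod_base2 z : ~ base z -> ord_mod_base iota z = 2%N <-> base (z ^+ 2).
Proof.
move=> zF; rewrite ord_mod_baseP //; split=> [[]//|z2]; split=> // -[|[|]] //.
Qed.

(** * Roots of unity of prime-power order *)

Variable zeta : nat -> L.
Hypothesis zetaP : primitive_roots_choice F zeta.

Lemma natr_iota n : (n%:R == 0 :> L) = (n%:R == 0 :> F).
Proof. by rewrite -(rmorph_nat iota) fmorph_eq0. Qed.

Lemma zeta_root n x : zeta_exists F n -> x ^+ n = 1 -> exists i, x = zeta n ^+ i.
Proof. by move=> /zetaP zn /(prim_rootP zn) [i ->]; exists i. Qed.

Lemma zeta_exists_dvd m n : (m %| n)%N -> zeta_exists F n -> zeta_exists F m.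
Proof.
move=> /dvdnP [c ->]; rewrite /zeta_exists natrM; apply: contraNN => /eqP ->.
by rewrite mulr0.
Qed.

Lemma zeta_dvd m n : (m %| n)%N -> zeta_exists F n -> exists i, zeta m = zeta n ^+ i.
Proof.
move=> mn nF; apply: zeta_root => //.
have /prim_expr_order zm := zetaP (zeta_exists_dvd mn nF).
by case/dvdnP: mn => c ->; rewrite mulnC exprM zm expr1n.
Qed.

Lemma zeta_exists_pow1 p : zeta_exists F (p ^ 0)%N.
Proof. exact: oner_neq0. Qed.

Lemma zeta1 : zeta 1 = 1.
Proof. by have /prim_expr_order := zetaP (zeta_exists_pow1 1); rewrite expr1. Qed.

(** The characteristic may divide [p ^ j], but never the exact order of [x], so passing to that
    order makes [zeta] available. *)
Lemma prime_power_root p j x : prime p -> x ^+ (p ^ j) = 1 ->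
  exists i, [/\ (p ^ i)%N.-primitive_root x, zeta_exists F (p ^ i)%N
              & exists c, zeta (p ^ i)%N = x ^+ c].
Proof.
move=> pr_p xj; have [|m xm] := prim_order_exists _ xj; first by rewrite expn_gt0 prime_gt0.
case/(dvdn_pfactor _ _ pr_p) => i _ em; rewrite {m}em in xm; exists i.
have iF : zeta_exists F (p ^ i)%N by rewrite /zeta_exists -natr_iota (prim_root_natf_neq0 xm).
split=> //; have /prim_expr_order zi := zetaP iF.
by have [c ->] := prim_rootP xm zi; exists c.
Qed.

Definition prime_power_roots (p : nat) : set L := [set x | exists j, x ^+ (p ^ j) = 1].

Lemma mu_powP p o (x : L) : prime p -> mu_pow p o x <->
  exists j, (if o is Some m then (j <= m)%N else true) /\ x ^+ (p ^ j) = 1.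
Proof.
move=> pr_p; case: o => [m|] /=; rewrite /mu /=; split.
- by move/unity_rootP => xm; exists m.
- move=> [j [jm xj]]; apply/unity_rootP.
  by rewrite -(subnK jm) expnD mulnC exprM xj expr1n.
- by move=> [j _ /unity_rootP xj]; exists j.
- by move=> [j [_ xj]]; exists j => //; apply/unity_rootP.
Qed.

(** The exponents [k] with [zeta (p ^ k)] in [K] form an initial segment. The base field gives
    [ell]; a quadratic extension will give [nu]. *)
Lemma mu_pow_max p K : prime p -> intermediate K ->
  mu_pow p (max_or_infty [set k | zeta_exists F (p ^ k)%N /\ K (zeta (p ^ k)%N)]) =
  K `&` prime_power_roots p.
Proof.
move=> pr_p intK; set A := [set k | _].
have A0 : A 0%N by split; [exact: zeta_exists_pow1 | rewrite expn0 zeta1; exact: intermediate1].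
have A_down i j : (i <= j)%N -> A j -> A i.
  move=> /(dvdn_exp2l p) ij [jF Kj]; split; first exact: zeta_exists_dvd jF.
  by have [c ->] := zeta_dvd ij jF; apply: intermediateX.
apply/seteqP; split=> x.
  move/(mu_powP _ _ pr_p) => [j [/(max_or_infty_prefix _ A0 A_down) [jF Kj] xj]].
  split; last by exists j.
  by have [i ->] := zeta_root jF xj; apply: intermediateX.
move=> [Kx [j xj]]; apply/mu_powP => //.
have [i [xi iF [c ec]]] := prime_power_root pr_p xj; exists i.
split; last exact: prim_expr_order.
by apply/(max_or_infty_prefix _ A0 A_down); split=> //; rewrite ec; apply: intermediateX.
Qed.

(** The root of smaller order is a power of the other one, hence a non-base element of the extension
    that the other one generates. *)
Lemma quadratic_zeta_tower p i j : zeta_exists F (p ^ i)%N -> zeta_exists F (p ^ j)%N ->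
    quadratic (zeta (p ^ i)%N) -> quadratic (zeta (p ^ j)%N) ->
  adjoin iota (zeta (p ^ i)%N) = adjoin iota (zeta (p ^ j)%N).
Proof.
wlog ij : i j / (i <= j)%N.
  by have [ij|/ltnW ij] := leqP i j => W *; [apply: W | apply/esym/W].
move=> iF jF [izF _] jq.
have Kj : adjoin iota (zeta (p ^ j)%N) (zeta (p ^ i)%N).
  have [c ->] := zeta_dvd (dvdn_exp2l p ij) jF.
  exact: (intermediateX (intermediate_adjoin _) _ (@adjoin_gen _)).
by have [] := quadratic_adjoin jq Kj izF.
Qed.

(** * The invariants [nu_plus] and [nu] *)

Lemma base_zeta_tF_odd p k : p != 2%N ->
  base (zeta (tF iota zeta p k) + (zeta (tF iota zeta p k))^-1) <->
  base (zeta (p ^ k)%N + (zeta (p ^ k)%N)^-1).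
Proof.
move=> p2; rewrite /tF (negPf p2) /=; case: eqP => // /ord_mod_base1 zF.
have bI := intermediate_base; rewrite zeta1 invr1.
by split=> _; apply: (intermediateD bI); rewrite ?invr1;
  [|exact: (intermediateV bI)|exact: (intermediate1 bI)|exact: (intermediate1 bI)].
Qed.

(** If [tF] is lowered to 1 or 2, its root is 1 or -1 up to sign and the left side holds; this
    happens only when [zeta (2 ^ k) ^+ 2] is in F. *)
Lemma base_zeta_tF_2 k : zeta_exists F (2 ^ k)%N ->
  base (zeta (tF iota zeta 2 k) + (zeta (tF iota zeta 2 k))^-1) <->
  base (zeta (2 ^ k)%N ^+ 2) \/ base (zeta (2 ^ k)%N + (zeta (2 ^ k)%N)^-1).
Proof.
move=> kF; have bI := intermediate_base; rewrite /tF eqxx /=.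
have b1 := intermediate1 bI.
case: eqP => [/ord_mod_base1 zF|/ord_mod_base1 zF].
  rewrite zeta1 invr1; split=> _; first by left; apply: intermediateX.
  exact: intermediateD.
case: eqP => [/(ord_mod_base2 zF) z2F|/(ord_mod_base2 zF) z2F]; last first.
  by split=> [|[]//]; right.
split=> _; first by left.
have : zeta 2 ^+ 2 == 1.
  apply/eqP/prim_expr_order/zetaP/(zeta_exists_dvd _ kF).
  by case: k zF {kF z2F} => [|k] zF; [rewrite expn0 zeta1 in zF | rewrite dvdn_exp].
rewrite sqrf_eq1 => /orP [] /eqP ->; rewrite ?invrN invr1; apply: (intermediateD bI) => //;
  exact: (intermediateN bI).
Qed.

(** [tF 2 e] is 2 when the order modulo F is 2, but could also be 2 as the power [2 ^ 1]; in both
    cases the square of the root is in F. *)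
Lemma property_C2P : property_C2 iota zeta <->
  exists e, [/\ zeta_exists F (2 ^ e)%N, ~ base (zeta (2 ^ e)%N),
    ~ base (zeta (2 ^ e)%N ^+ 2) & base (zeta (2 ^ e)%N - (zeta (2 ^ e)%N)^-1)].
Proof.
have b1 := intermediate1 intermediate_base.
split=> [[e [e0 eF zF t2 zV]]|[e [eF zF z2F zV]]]; exists e; split=> //.
- move=> z2F; have o2 := (ord_mod_base2 zF).2 z2F; apply: t2.
  by rewrite /tF o2.
- by case: e zF {eF z2F zV} => //; rewrite expn0 zeta1.
- rewrite /tF eqxx /=; case: eqP => // _; case: eqP => [o2|_] /=; first by have := (ord_mod_base2 zF).1 o2.
  rewrite -{2}(expn1 2) => /eqP; rewrite eqn_exp2l // => /eqP e1.
  apply: z2F; rewrite e1 expn1.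
  have /prim_expr_order -> // : (2%N).-primitive_root (zeta 2).
  by apply: zetaP; move: eF; rewrite e1.
Qed.

Section QuadraticTower.
Variables p e : nat.
Hypotheses (pr_p : prime p) (eF : zeta_exists F (p ^ e)%N).
Hypothesis qe : quadratic (zeta (p ^ e)%N).
Local Notation K := (adjoin iota (zeta (p ^ e)%N)).

Lemma adjoin_zeta k : zeta_exists F (p ^ k)%N ->
  K (zeta (p ^ k)%N) <-> base (zeta (p ^ k)%N) \/ quadratic (zeta (p ^ k)%N).
Proof.
move=> kF; have intK := intermediate_adjoin (zeta (p ^ e)%N); split.
  move=> Kk; have [|zF] := pselect (base (zeta (p ^ k)%N)); first by left.
  by right; have [] := quadratic_adjoin qe Kk zF.
case=> [|kq]; first by apply: intK.2.
by rewrite (quadratic_zeta_tower eF kF qe kq); apply: adjoin_gen.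
Qed.

Lemma nu_plus_odd : p != 2%N ->
  nu_plus iota zeta p =
  max_or_infty [set k | zeta_exists F (p ^ k)%N /\ K (zeta (p ^ k)%N)].
Proof.
move=> p2; have bI := intermediate_base; rewrite /nu_plus; congr max_or_infty.
apply/seteqP; split=> k [kF].
  move/(base_zeta_tF_odd _ p2) => zV; split=> //; apply/adjoin_zeta => //.
  have [|zF] := pselect (base (zeta (p ^ k)%N)); [by left | right].
  exact: quadratic_addV.
move/(adjoin_zeta kF) => zK; split=> //; apply/(base_zeta_tF_odd _ p2).
case: zK => [zF|]; first by apply: (intermediateD bI) => //; apply: (intermediateV bI).
by apply: (quadratic_odd_prime pr_p _ (zetaP kF)); case: (even_prime pr_p) p2 => // ->.
Qed.

End QuadraticTower.

Lemma adjoin_zeta2 e k : zeta_exists F (2 ^ e)%N -> quadratic (zeta (2 ^ e)%N) ->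
    zeta_exists F (2 ^ k)%N ->
  adjoin iota (zeta (2 ^ e)%N) (zeta (2 ^ k)%N) <->
  [\/ base (zeta (2 ^ k)%N ^+ 2), base (zeta (2 ^ k)%N + (zeta (2 ^ k)%N)^-1)
    | base (zeta (2 ^ k)%N - (zeta (2 ^ k)%N)^-1)].
Proof.
move=> eF qe kF; rewrite adjoin_zeta //; split=> [[zF|]|].
- by constructor 1; apply: (intermediateX intermediate_base).
- exact: quadratic_2pow (zetaP kF).
move=> zP; have [|zF] := pselect (base (zeta (2 ^ k)%N)); [by left | right].
case: zP; [exact: quadratic_sq | exact: quadratic_addV | exact: quadratic_subV].
Qed.

(* With [z = zeta (2 ^ e)] a witness of property C2, [z ^+ 2 + z ^- 2] lies in
   the base field and [z + z^-1] does not, so that the maximum defining [nu_plus]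
   is reached at [e.-1]. *)
Lemma nu_plus_C2 e : zeta_exists F (2 ^ e)%N -> ~ base (zeta (2 ^ e)%N) ->
    ~ base (zeta (2 ^ e)%N ^+ 2) -> base (zeta (2 ^ e)%N - (zeta (2 ^ e)%N)^-1) ->
  [/\ (0 < e)%N, nu_plus iota zeta 2 = Some e.-1 &
      forall k, zeta_exists F (2 ^ k)%N ->
        base (zeta (2 ^ k)%N ^+ 2) \/ base (zeta (2 ^ k)%N + (zeta (2 ^ k)%N)^-1) ->
        (k < e)%N].
Proof.
have bI := intermediate_base; move=> eF zF z2F zV.
have e0 : (0 < e)%N.
  by case: e zF {eF z2F zV} => //; rewrite expn0 zeta1; case; exact: (intermediate1 bI).
have nz : zeta (2 ^ e)%N != 0 by rewrite (prim_root_eq0 (zetaP eF)) -lt0n expn_gt0.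
have e1F : zeta_exists F (2 ^ e.-1)%N by apply: zeta_exists_dvd eF; rewrite dvdn_exp2l ?leq_pred.
(* Otherwise 2 would vanish, although [zeta (2 ^ e)] exists with [e] positive. *)
have not_plus : ~ base (zeta (2 ^ e)%N + (zeta (2 ^ e)%N)^-1).
  move=> zV'; have := intermediate_subK bI zV' zV zF; apply/eqP.
  by have := zeta_exists_dvd (dvdn_exp e0 (dvdnn 2)) eF; rewrite /zeta_exists -natr_iota.
have below : forall k, zeta_exists F (2 ^ k)%N ->
    base (zeta (2 ^ k)%N ^+ 2) \/ base (zeta (2 ^ k)%N + (zeta (2 ^ k)%N)^-1) -> (k < e)%N.
  move=> k kF zP; rewrite ltnNge; apply/negP => ek.
  have [c ec] := zeta_dvd (dvdn_exp2l 2 ek) kF.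
  case: zP => zP.
    by apply: z2F; rewrite ec exprAC; apply: (intermediateX bI).
  apply: not_plus; rewrite ec; apply: base_addV_exp => //.
  by rewrite (prim_root_eq0 (zetaP kF)) -lt0n expn_gt0.
split=> //; apply: max_or_infty_Some => [|k [kF /(base_zeta_tF_2 kF)/(below k kF)]]; last first.
  by lia.
split=> //; apply/base_zeta_tF_2 => //; right.
have [c ->] : exists c, zeta (2 ^ e.-1)%N = (zeta (2 ^ e)%N ^+ 2) ^+ c.
  have /prim_rootP zr : (2 ^ e.-1)%N.-primitive_root (zeta (2 ^ e)%N ^+ 2).
    have -> : (2 ^ e.-1 = 2 ^ e %/ gcdn 2 (2 ^ e))%N.
      by rewrite -(prednK e0) expnS gcdnMr mulKn.
    exact: (exp_prim_root (zetaP eF) 2).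
  have [c ->] := zr _ (prim_expr_order (zetaP e1F)); by exists c.
apply: base_addV_exp; first exact: expf_neq0.
have -> : zeta (2 ^ e)%N ^+ 2 + (zeta (2 ^ e)%N ^+ 2)^-1 =
    (zeta (2 ^ e)%N - (zeta (2 ^ e)%N)^-1) ^+ 2 + 2 by field.
apply: (intermediateD bI); first exact: (intermediateX bI).
by rewrite -(rmorph_nat iota 2); exact: (intermediate_iota bI).
Qed.

(** Without property C2 the sets of exponents agree. With it, a witness [w] lies in the tower and
    [nu] equals [w], so no larger exponent may occur. *)
Lemma nu_max p e : prime p -> zeta_exists F (p ^ e)%N -> quadratic (zeta (p ^ e)%N) ->
  nu iota zeta p = max_or_infty
    [set k | zeta_exists F (p ^ k)%N /\ adjoin iota (zeta (p ^ e)%N) (zeta (p ^ k)%N)].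
Proof.
move=> pr_p eF qe; rewrite /nu.
have [p2|p2] := eqVneq p 2%N; last by rewrite /= (nu_plus_odd pr_p eF qe).
subst p => /=; case: asboolP => [/property_C2P [w [wF zF z2F zV]]|nC2].
  have [w0 -> below] := nu_plus_C2 wF zF z2F zV; rewrite /= (prednK w0).
  apply/esym/max_or_infty_Some.
    by split=> //; apply/adjoin_zeta2 => //; constructor 3.
  move=> k [kF /(adjoin_zeta2 eF qe kF) kP].
  have [k2F|k2F] := pselect (base (zeta (2 ^ k)%N ^+ 2)).
    by apply/ltnW/below => //; left.
  case: kP => [//|kV|kV]; first by apply/ltnW/below => //; right.
  have [kb|kb] := pselect (base (zeta (2 ^ k)%N)).
    by case: k2F; apply: (intermediateX intermediate_base).
  (* Here [k] is itself a witness of property C2, and two witnesses coincide because each is one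
     more than the maximum in [nu_plus]. *)
  have [k0 ek _] := nu_plus_C2 kF kb k2F kV; have [_ + _] := nu_plus_C2 wF zF z2F zV.
  by rewrite ek => -[]; lia.
rewrite /nu_plus; congr max_or_infty; apply/seteqP; split=> k [kF].
  move/(base_zeta_tF_2 kF) => zP; split=> //; apply/adjoin_zeta2 => //.
  by case: zP; [constructor 1 | constructor 2].
move/(adjoin_zeta2 eF qe kF) => zP; split=> //; apply/base_zeta_tF_2 => //.
case: zP => [|| zV]; [by left | by right |].
have [z2F|z2F] := pselect (base (zeta (2 ^ k)%N ^+ 2)); first by left.
case: nC2; apply/property_C2P; exists k; split=> // zF; apply: z2F; exact: (intermediateX intermediate_base).
Qed.

(** * Prime-power components and joins of groups of roots of unity *)

Lemma unity_coprime_split (a b : nat) (x : L) : coprime a b -> x ^+ (a * b) = 1 ->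
  exists c d, [/\ x = x ^+ c * x ^+ d, (x ^+ c) ^+ a = 1 & (x ^+ d) ^+ b = 1].
Proof.
move=> cab xab.
have expr_dvd m : (a * b %| m)%N -> x ^+ m = 1.
  by case/dvdnP => c ->; rewrite mulnC exprM xab expr1n.
(* Chinese remainders: [c + d] is 1 modulo [a * b], with [b] dividing [c] and [a] dividing [d]. *)
pose c := chinese a b 1 0; pose d := chinese a b 0 1.
have bc : (b %| c)%N by rewrite /dvdn chinese_modr // mod0n.
have ad : (a %| d)%N by rewrite /dvdn chinese_modl // mod0n.
exists c, d; split; last 2 first.
- by rewrite -exprM; apply: expr_dvd; rewrite mulnC dvdn_mul.
- by rewrite -exprM; apply: expr_dvd; rewrite dvdn_mul.
rewrite -exprD -[LHS]expr1 -(expr_mod 1 xab) -(expr_mod (c + d) xab); congr (x ^+ _).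
apply/esym/eqP; rewrite chinese_remainder //; apply/andP; split; apply/eqP.
  by rewrite -modnDmr (eqP ad) addn0 chinese_modl.
by rewrite -modnDml (eqP bc) add0n chinese_modr.
Qed.

(** Induction on [n], splitting off the part at its smallest prime divisor. The factors are powers
    of [x], so they stay in every field containing [x]. *)
Lemma unity_prime_power_decomp n x : (0 < n)%N -> x ^+ n = 1 ->
  exists2 s : seq L, x = \prod_(y <- s) y &
    forall y, y \in s -> (exists c, y = x ^+ c) /\
      exists2 p, prime p & prime_power_roots p y.
Proof.
elim/ltn_ind: n x => n IHn x n0 xn.
have [n1|n1] := leqP n 1.
  exists [::] => //; rewrite big_nil -xn.
  by have -> : n = 1%N by lia.
pose p := pdiv n; have pr_p : prime p by apply: pdiv_prime.
have [m cpm en] := pfactor_coprime pr_p n0.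
have l0 : (0 < logn p n)%N by rewrite logn_gt0 mem_primes pr_p n0 pdiv_dvd.
have m0 : (0 < m)%N by move: n0; rewrite en muln_gt0 => /andP[].
have cab : coprime (p ^ logn p n) m by rewrite coprimeXl.
have [|c [d [ex xc xd]]] := @unity_coprime_split (p ^ logn p n) m x cab.
  by rewrite mulnC -en.
have mn : (m < n)%N.
  by rewrite [X in (_ < X)%N]en ltn_Pmulr // -(exp1n (logn p n)) ltn_exp2r ?prime_gt1.
have [s es sP] := IHn m mn _ m0 xd; exists (x ^+ c :: s).
  by rewrite big_cons -es.
move=> y; rewrite inE => /orP [/eqP ->|/sP [[k ->] yp]].
  by split; [exists c | exists p => //; exists (logn p n)].
by split=> //; exists (d * k)%N; rewrite exprM.
Qed.

Lemma roots_of_unityP x :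
  @roots_of_unity L x <-> exists2 n, (0 < n)%N & x ^+ n = 1.
Proof. by split=> -[n n0 /unity_rootP xn]; exists n => //; apply/unity_rootP. Qed.

Lemma join_prime_power_roots K (G : nat -> set L) : intermediate K ->
    (forall p, prime p -> G p = K `&` prime_power_roots p) ->
  join [set G p | p in primes_set] = @roots_of_unity L `&` K.
Proof.
move=> intK GP; apply/seteqP; split=> x.
  move=> [s sG ->].
  have {}sG y : y \in s -> K y /\ exists2 n, (0 < n)%N & y ^+ n = 1.
    move=> /sG [_ [p pr_p <-]]; rewrite (GP _ pr_p) => -[Ky [j yj]].
    by split=> //; exists (p ^ j)%N; rewrite // expn_gt0 prime_gt0.
  split; last by apply: (intermediate_prod intK) => y /sG [].
  apply/roots_of_unityP; elim: s sG => [|y s IHs] sG.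
    by exists 1%N; rewrite // big_nil expr1.
  have [|m m0 sm] := IHs; first by move=> w ws; apply: sG; rewrite inE ws orbT.
  have [_ [n n0 yn]] := sG _ (mem_head _ _).
  exists (n * m)%N; first by rewrite muln_gt0 n0.
  by rewrite big_cons exprMn exprM yn expr1n mulnC exprM sm expr1n mulr1.
move=> [/roots_of_unityP [n n0 xn] Kx].
have [s es sP] := unity_prime_power_decomp n0 xn; exists s => // y /sP [[c ->] [p pr_p yp]].
exists (G p); first by exists p.
by rewrite GP //; split=> //; apply: (intermediateX intK).
Qed.

Lemma mu_ell_joinE : mu_ell_join iota zeta = @roots_of_unity L `&` base.
Proof.
apply: join_prime_power_roots intermediate_base _ => p pr_p.
exact: (mu_pow_max pr_p intermediate_base).
Qed.

(** * Quadratic cyclotomic extensions and their sets of primes *)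

Lemma M2P z : M2 iota z <-> @roots_of_unity L z /\ quadratic z.
Proof.
by split=> -[zr zq]; split=> //; [apply: quadratic_has_degree | apply: has_degree_quadratic].
Qed.

Lemma zeta_M2 n : zeta_exists F n -> M2 iota (zeta n) <-> quadratic (zeta n).
Proof.
move=> nF; rewrite M2P; split=> [[]|] //; split=> //; apply/roots_of_unityP.
exists n; last exact: prim_expr_order (zetaP nF).
by rewrite lt0n; apply: contraNneq nF => ->.
Qed.

Lemma C2_intermediate K : C2 iota K -> intermediate K.
Proof. by move=> [z _ <-]; apply: intermediate_adjoin. Qed.

Lemma C2_generator K x : C2 iota K -> K x -> ~ base x ->
  quadratic x /\ adjoin iota x = K.
Proof. by move=> [z /M2P [_ zq] <-]; apply: quadratic_adjoin. Qed.

(** The map from [C2] to [SF_max] that gives the bijection. *)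
Definition generating_primes (K : set L) : set nat :=
  [set p | prime p /\ exists e, [/\ zeta_exists F (p ^ e)%N,
     quadratic (zeta (p ^ e)%N) & adjoin iota (zeta (p ^ e)%N) = K]].

Lemma generating_primes_root K x p : C2 iota K -> prime p ->
  K x -> ~ base x -> prime_power_roots p x -> generating_primes K p.
Proof.
move=> KC pr_p Kx xF [j xj]; split=> //.
have [i [xi iF [c ec]]] := prime_power_root pr_p xj; exists i.
have zK : K (zeta (p ^ i)%N) by rewrite ec; apply: (intermediateX (C2_intermediate KC)).
have zF : ~ base (zeta (p ^ i)%N).
  move=> zF; apply: xF; have [d ->] := zeta_root iF (prim_expr_order xi).
  exact: (intermediateX intermediate_base).
by have [] := C2_generator KC zK zF.
Qed.

Lemma generating_primes_neq0 K : C2 iota K -> generating_primes K !=set0.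
Proof.
move=> KC; have [z /M2P [/roots_of_unityP [n n0 zn] [zF _]] Kz] := KC.
have [s es sP] := unity_prime_power_decomp n0 zn.
have [y [ys yF]] : exists y, y \in s /\ ~ base y.
  apply: contrapT => sF; apply: zF; rewrite es.
  apply: (intermediate_prod intermediate_base) => y ys.
  by apply: contrapT => yF; apply: sF; exists y.
have [[c ey] [p pr_p yp]] := sP _ ys; exists p.
apply: generating_primes_root yF yp => //; rewrite -Kz ey.
exact: (intermediateX (intermediate_adjoin z) _ (@adjoin_gen z)).
Qed.

(** A single common prime determines the extension, by the tower property. *)
Lemma generating_primes_inj K K' p :
  generating_primes K p -> generating_primes K' p -> K = K'.
Proof.
by move=> [_ [i [iF iq <-]]] [_ [j [jF jq <-]]]; apply: quadratic_zeta_tower.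
Qed.

(** At a generating prime [nu] bounds the roots in [K]; at any other prime the p-power roots of
    unity in [K] are already in F, so [ell] bounds them. *)
Lemma mu_nu_ell_joinE K : C2 iota K ->
  mu_nu_ell_join iota zeta (generating_primes K) = @roots_of_unity L `&` K.
Proof.
move=> KC; have intK := C2_intermediate KC.
pose G p := if `[< generating_primes K p >] then mu_pow p (nu iota zeta p) : set L
            else mu_pow p (ell iota zeta p).
rewrite -(@join_prime_power_roots K G) // => [|p pr_p].
  congr join; apply/seteqP; split=> H.
    case=> -[p Kp <-]; exists p; rewrite ?/G.
    - by case: Kp.
    - by rewrite asboolT.
    - by case: Kp.
    - by rewrite asboolF //; case: Kp.
  move=> [p pr_p <-]; rewrite /G; case: asboolP => Kp; [left | right]; by exists p.
rewrite /G; case: asboolP => [[_ [e [eF qe <-]]]|Kp].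
  by rewrite (nu_max pr_p eF qe); apply: mu_pow_max => //; apply: intermediate_adjoin.
rewrite [LHS](mu_pow_max pr_p intermediate_base).
apply/seteqP; split=> x [xK xp]; split=> //; first exact: intK.2.
by apply: contrapT => xF; apply: Kp; apply: generating_primes_root xF xp.
Qed.

Lemma coprime_prime_pow_prod p a (s : seq nat) (e : nat -> nat) : prime p ->
  (forall q, q \in s -> prime q) -> p \notin s ->
  coprime (p ^ a) (\prod_(q <- s) q ^ e q)%N.
Proof.
move=> pr_p; elim: s => [|q s IHs] s_pr; first by rewrite big_nil coprimen1.
rewrite inE negb_or => /andP [npq ps]; rewrite big_cons coprimeMr IHs //; last first.
  by move=> r rs; apply: s_pr; rewrite inE rs orbT.
rewrite andbT coprimeXl // coprimeXr // prime_coprime // dvdn_prime2 //.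
by apply: s_pr; rewrite mem_head.
Qed.

(** The claim concerns all roots of the product order, because the values of [zeta] at different
    orders are chosen independently. *)
Lemma intermediate_root_prod K (s : seq nat) (e : nat -> nat) : intermediate K ->
    uniq s -> (forall q, q \in s -> [/\ prime q, zeta_exists F (q ^ e q)%N
                                      & K (zeta (q ^ e q)%N)]) ->
  zeta_exists F (\prod_(q <- s) q ^ e q)%N /\
  forall x, x ^+ (\prod_(q <- s) q ^ e q)%N = 1 -> K x.
Proof.
move=> intK; elim: s => [|q s IHs] /=.
  move=> _ _; rewrite big_nil; split; first exact: zeta_exists_pow1 0%N.
  by move=> x; rewrite expr1 => ->; apply: (intermediate1 intK).
move=> /andP [qs us] sP.
have s'P r : r \in s -> [/\ prime r, zeta_exists F (r ^ e r)%N & K (zeta (r ^ e r)%N)].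
  by move=> rs; apply: sP; rewrite inE rs orbT.
have [sF sK] := IHs us s'P; have [pr_q qF qK] := sP _ (mem_head _ _).
rewrite big_cons; split; first by rewrite /zeta_exists natrM mulf_neq0.
have cqs : coprime (q ^ e q) (\prod_(r <- s) r ^ e r)%N.
  by apply: coprime_prime_pow_prod => // r /s'P [].
move=> x /(unity_coprime_split cqs) [c [d [ex xc xd]]]; rewrite ex.
apply: (intermediateM intK); last exact: (sK _ xd).
by have [i ->] := zeta_root qF xc; apply: (intermediateX intK).
Qed.

(** The sets [B] with at most two elements already force a common extension. Conversely, for every
    [B] the root of product order lies in [K]. *)
Lemma SFP S : SF iota zeta S <->
  S !=set0 /\ exists2 K, C2 iota K & S `<=` generating_primes K.
Proof.
have dvd_prod p (s : seq nat) (e : nat -> nat) : p \in s ->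
    (p ^ e p %| \prod_(q <- s) q ^ e q)%N.
  by move=> ps; rewrite (big_rem p) //= dvdn_mulr.
split=> [[[p0 Sp0] Spr [e [eP eB]]]|[S0 [K KC SK]]].
  split; first by exists p0.
  have [e0 e0F /[dup] e0M /(zeta_M2 e0F) e0q] := eP _ Sp0.
  exists (adjoin iota (zeta (p0 ^ e p0)%N)); first by exists (zeta (p0 ^ e p0)%N).
  move=> p Sp; have [_ eF /(zeta_M2 eF) qe] := eP _ Sp.
  split; [exact: Spr | exists (e p); split=> //].
  pose B := [fset p0; p]%fset.
  have [||nF /(zeta_M2 nF) nq] := eB B.
  - by apply/fset0Pn; exists p0; rewrite !inE eqxx.
  - by move=> q; rewrite /= !inE => /orP [] /eqP ->.
  have gen q : q \in B -> zeta_exists F (q ^ e q)%N -> quadratic (zeta (q ^ e q)%N) ->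
      adjoin iota (zeta (q ^ e q)%N) = adjoin iota (zeta (\prod_(p <- B) p ^ e p)%N).
    move=> qB qF [zF _].
    have nq' : adjoin iota (zeta (\prod_(p <- B) p ^ e p)%N) (zeta (q ^ e q)%N).
      have [c ->] := zeta_dvd (dvd_prod q B e qB) nF.
      exact: (intermediateX (intermediate_adjoin _) _ (@adjoin_gen _)).
    by have [] := quadratic_adjoin nq nq' zF.
  by rewrite (gen p) ?(gen p0) // !inE eqxx ?orbT.
have intK := C2_intermediate KC.
have exponents p : exists k, S p -> [/\ zeta_exists F (p ^ k)%N,
    quadratic (zeta (p ^ k)%N) & adjoin iota (zeta (p ^ k)%N) = K].
  have [/SK [_ [k kP]]|nSp] := pselect (S p); [by exists k | by exists 0%N].
have [e eP] := choice exponents.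
split=> //; first by move=> p /SK [].
exists e; split=> [p Sp|B B0 BS].
  have [eF qe _] := eP _ Sp; split=> //; last exact/zeta_M2.
  case: (posnP (e p)) qe => // ->; rewrite expn0 zeta1 => -[]; case.
  exact: (intermediate1 intermediate_base).
have [||nF nK] := @intermediate_root_prod K B e intK.
- exact: fset_uniq.
- move=> q qB; have Sq : S q by apply: BS.
  have [qF _ <-] := eP _ Sq; split=> //; first by have [] := SK _ Sq.
  exact: adjoin_gen.
split=> //; apply/zeta_M2 => //.
have [] // := @C2_generator K (zeta (\prod_(p <- B) p ^ e p)%N) KC.
  by apply: nK; apply: prim_expr_order; apply: zetaP.
(* The root of product order is not in F, since [zeta (q ^ e q)] is one of its powers. *)
have /fset0Pn [q qB] := B0; have [_ [qnF _] _] := eP q (BS q qB).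
move=> nb; apply: qnF; have [c ->] := zeta_dvd (dvd_prod q B e qB) nF.
exact: (intermediateX intermediate_base).
Qed.

Lemma generating_primes_SF K : C2 iota K -> SF iota zeta (generating_primes K).
Proof. by move=> KC; apply/SFP; split; [apply: generating_primes_neq0 | exists K]. Qed.

Lemma SF_maxP M :
  SF_max iota zeta M <-> exists2 K, C2 iota K & M = generating_primes K.
Proof.
split=> [[/SFP [M0 [K KC MK]] [C [[CS Ctot] Cmax] eM]]|[K KC ->]].
  exists K => //; apply/seteqP; split=> //.
  have CK S : C S -> S `<=` generating_primes K.
    by move=> CS' p Sp; apply: MK; rewrite eM; exists S.
  (* Every member of the chain is contained in [generating_primes K], so adjoining that set keeps a
     chain and maximality puts it in [C]. *)
  have CE : C `|` [set generating_primes K] = C.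
    apply: Cmax; last by move=> S; left.
    split=> [S [/CS //|->]|S T]; first exact: generating_primes_SF.
    move=> [CS'|->] [CT|->]; [exact: Ctot | left; exact: CK | right; exact: CK | by left].
  by move=> p Kp; rewrite eM -CE; exists (generating_primes K) => //; right.
have KS := generating_primes_SF KC; split=> //.
(* Zorn's lemma is to give a maximal chain through [generating_primes K]; adjoining this set inside
   [P] also covers the union of an empty family. *)
pose P (C : set (set nat)) := is_chain (SF iota zeta) (C `|` [set generating_primes K]).
have [|A [[AS Atot] Amax]] := @Zorn_bigcup _ P.
  move=> Fam FamP Famtot; split=> [S [[C FC CS]|->//]|S T].
    by apply: (FamP _ FC).1; left.
  move=> [[C FC CS]|->] [[D FD DT]|->].
  - have [CD|DC] := Famtot _ _ FC FD.
      by apply: (FamP _ FD).2; left=> //; apply: CD.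
    by apply: (FamP _ FC).2; left=> //; apply: DC.
  - by apply: (FamP _ FC).2; [left | right].
  - by apply: (FamP _ FD).2; [right | left].
  - by left.
exists (A `|` [set generating_primes K]).
  split=> // D Dc AD; apply/seteqP; split=> // S DS; left; apply: contrapT => nAS.
  apply: (Amax D); last first.
    rewrite /P; have -> // : D `|` [set generating_primes K] = D.
    by apply/seteqP; split=> [T [//|->]|T]; [apply: AD; right | left].
  by split=> [T AT|/(_ _ DS)//]; apply: AD; left.
apply/seteqP; split=> [p Kp|p [S AS' Sp]]; first by exists (generating_primes K) => //; right.
(* A member [S] above [generating_primes K] lies in some [generating_primes K']; a shared prime
   gives [K = K']. *)
have [] := Atot S (generating_primes K) AS'; [by right | by apply | move=> KS'].
have /SFP [_ [K' KC' SK']] := AS _ AS'.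
have [q Kq] := generating_primes_neq0 KC.
by rewrite (generating_primes_inj Kq (SK' _ (KS' _ Kq))); apply: SK'.
Qed.

End CyclotomicExtensions.

Theorem theorem2 (F : fieldType) (L : closedFieldType)
    (iota : {rmorphism F -> L}) (algL : forall x : L, algebraicOver iota x)
    (zeta : nat -> L) (zetaP : primitive_roots_choice F zeta) :
  (M2 iota =
     \bigcup_(M in SF_max iota zeta)
       (mu_nu_ell_join iota zeta M `\` mu_ell_join iota zeta)
   /\ trivIset (SF_max iota zeta)
        (fun M => mu_nu_ell_join iota zeta M `\` mu_ell_join iota zeta))
  /\ C2 iota #= SF_max iota zeta.
Proof.
(* Each part of the union consists of the quadratic roots of unity generating one [K]: covering and
   disjointness both follow. *)
have partE K z : C2 iota K ->
    (mu_nu_ell_join iota zeta (generating_primes iota zeta K) `\` mu_ell_join iota zeta) z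
    <-> M2 iota z /\ adjoin iota z = K.
  move=> KC; rewrite mu_nu_ell_joinE // mu_ell_joinE //; split.
    move=> [[zr Kz] nz]; have [|zq eK] := C2_generator KC Kz; first by move=> zF; apply: nz.
    by split=> //; apply/M2P.
  move=> [/M2P [zr [zF _]] <-]; split; first by split=> //; apply: adjoin_gen.
  by case.
split; first split.
- apply/seteqP; split=> z.
    move=> zM; have KC : C2 iota (adjoin iota z) by exists z.
    exists (generating_primes iota zeta (adjoin iota z)); last exact/partE.
    by apply/SF_maxP => //; exists (adjoin iota z).
  by move=> [_ /(SF_maxP iota zetaP) [K KC ->] /(partE _ _ KC) []].
- move=> _ _ /(SF_maxP iota zetaP) [K KC ->] /(SF_maxP iota zetaP) [K' KC' ->] [z [zK zK']].
  have [_ <-] := (partE _ _ KC).1 zK; by have [_ ->] := (partE _ _ KC').1 zK'.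
apply/card_set_bijP; exists (generating_primes iota zeta); split.
- by move=> K KC; apply/SF_maxP => //; exists K.
- move=> K K'; rewrite !inE => KC KC' e.
  have [p Kp] := generating_primes_neq0 zetaP KC.
  by apply: (generating_primes_inj zetaP Kp); rewrite -e.
- by move=> _ /(SF_maxP iota zetaP) [K KC ->]; exists K.
Qed.
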